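(* Let $m\ge 1$ be an integer and $0<\varepsilon\le 1$. For the problem $P_m|\varepsilon,\mathrm{online}|\sum p_j(1-U_j)$ (online maximization of total accepted processing time on $m$ parallel identical machines, without preemption, with immediate and irrevocable acceptance and allocation decisions, and slack factor $\varepsilon$) there is a deterministic online algorithm with strict competitive ratio at most $$m\cdot\left(\frac{1+\varepsilon}{\varepsilon}\right)^{\frac1m}+1.$$
   Context: Problem. There are $m$ parallel identical machines and a finite sequence $\mathcal{J}$ of jobs. Job $J_j$ has release (submission) date $r_j\ge 0$, processing time $p_j>0$ and deadline $d_j$ satisfying the slack condition $d_j-r_j\ge(1+\varepsilon)p_j$. The sequence is ordered so that $J_i$ precedes $J_j$ whenever $r_i<r_j$ (several jobs may have the same release date). Jobs are revealed in sequence order; job $J_j$ becomes known at time $r_j$, and the online algorithm must decide immediately, before seeing any later job of the sequence, whether to accept it ($U_j=0$) or reject it ($U_j=1$). If it accepts the job it must also immediately and irrevocably fix the machine and the starting time of the job. An accepted job is processed without interruption on a single machine, starting no earlier than $r_j$ and completing no later than $d_j$; a machine processes at most one job at a time. The objective is to maximize $\sum_j p_j(1-U_j)$. Let $\mathrm{ALG}(\mathcal{J})$ be the objective value of the online algorithm and $\mathrm{OPT}(\mathcal{J})$ the optimal offline value, i.e. the maximum total processing time of a subset of the jobs of $\mathcal{J}$ that has a non-preemptive schedule on $m$ machines in which every job of the subset is processed between its release date and its deadline. The algorithm has strict competitive ratio (at most) $c$ if $\mathrm{OPT}(\mathcal{J})\le c\cdot\mathrm{ALG}(\mathcal{J})$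 for every job sequence $\mathcal{J}$ satisfying the slack condition. *)

(* Defs.v *)
From HB Require Import structures.
From mathcomp Require Import all_boot all_order all_algebra.
From mathcomp Require Import boolp reals exp.

Set Implicit Arguments.
Unset Strict Implicit.
Unset Printing Implicit Defensive.

Import Order.TTheory GRing.Theory Num.Theory.
Local Open Scope ring_scope.

Record job (R : realType) : Type := Job {
  release : R;
  proc : R;
  deadline : R
}.

(* Jobs of a sequence are designated by their position, since distinct jobs
   may have the same parameters. *)
Definition job_at (R : realType) (J : seq (job R)) (i : 'I_(size J)) : job R :=
  tnth (in_tuple J) i.

Definition valid_instance (R : realType) (eps : R) (J : seq (job R)) : Prop :=
  (forall i : 'I_(size J),
     [/\ 0 <= release (job_at i),
         0 < proc (job_at i) &
         (1 + eps) * proc (job_at i)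
           <= deadline (job_at i) - release (job_at i)]) /\
  (forall i k : 'I_(size J),
     release (job_at i) < release (job_at k) -> (i < k)%N).

(* [None] rejects the job; [Some (M, t)] accepts it and starts it at time [t]
   on machine [M]. *)
Definition decision (R : realType) (m : nat) : Type := option ('I_m * R).

Definition schedule (R : realType) (m : nat) (J : seq (job R)) : Type :=
  'I_(size J) -> decision R m.

Definition accepted (R : realType) (m : nat) (J : seq (job R))
    (S : schedule m J) : {set 'I_(size J)} :=
  [set i | isSome (S i)].

Definition feasible (R : realType) (m : nat) (J : seq (job R))
    (S : schedule m J) : Prop :=
  (forall (i : 'I_(size J)) (M : 'I_m) (t : R), S i = Some (M, t) ->
     release (job_at i) <= t /\ t + proc (job_at i) <= deadline (job_at i)) /\
  (forall (i k : 'I_(size J)) (M : 'I_m) (t u : R), i <> k ->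
     S i = Some (M, t) -> S k = Some (M, u) ->
     t + proc (job_at i) <= u \/ u + proc (job_at k) <= t).

Definition load (R : realType) (J : seq (job R)) (A : {set 'I_(size J)}) : R :=
  \sum_(i in A) proc (job_at i).

Definition schedulable (R : realType) (m : nat) (J : seq (job R))
    (A : {set 'I_(size J)}) : Prop :=
  exists S : schedule m J, feasible S /\ accepted S = A.

(* The default value 0 of the maximum is the load of the empty set, which is
   always schedulable. *)
Definition OPT (R : realType) (m : nat) (J : seq (job R)) : R :=
  \big[Num.max/0]_(A : {set 'I_(size J)} | `[< schedulable m A >]) load A.

(* The decision on a job depends on the jobs that precede it in the sequence
   and on the job itself; the earlier decisions need not be an argument, because
   a deterministic algorithm can recompute them from the earlier jobs. *)
Definition online_algorithm (R : realType) (m : nat) : Type :=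
  seq (job R) -> job R -> decision R m.

Definition online_schedule (R : realType) (m : nat) (alg : online_algorithm R m)
    (J : seq (job R)) : schedule m J :=
  fun i => alg (take i J) (job_at i).
Arguments online_schedule {R m} alg J _.

Definition ALG (R : realType) (m : nat) (alg : online_algorithm R m)
    (J : seq (job R)) : R :=
  load (accepted (online_schedule alg J)).

Definition correct (R : realType) (m : nat) (eps : R)
    (alg : online_algorithm R m) : Prop :=
  forall J : seq (job R), valid_instance eps J ->
    feasible (online_schedule alg J).

Definition strictly_competitive (R : realType) (m : nat) (eps c : R)
    (alg : online_algorithm R m) : Prop :=
  forall J : seq (job R), valid_instance eps J -> OPT m J <= c * ALG alg J.

(* Main.v *)
(* Put q = ((1 + eps) / eps)^(1/m), let l_1 >= ... >= l_m be the loads that the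
   machines still have to process at time r, and T(r) = max_k q^k l_k. The
   algorithm accepts a job (r, p, d) exactly when d - r >= T(r), and puts it on
   the most loaded machine on which it still meets its deadline. Such a machine
   exists: q^m l_m <= d - r and (1 + eps) p <= d - r add up to
   l_m + p <= d - r. Accepting the job raises T by at most q p, and
   r + T(r) does not increase while no job is accepted and T > 0. Hence the
   union W of the windows [r, r + T(r)) has measure at most q ALG. A rejected
   job has d < r + T(r), so it lies in W, and m machines can process at most
   m |W| of rejected jobs. *)

Require Import Defs.
From HB Require Import structures.
From mathcomp Require Import all_boot all_order all_algebra.
From mathcomp Require Import boolp reals exp.
From mathcomp Require Import lra classical_sets constructive_ereal.
From mathcomp Require Import measure lebesgue_measure.

Set Implicit Arguments.
Unset Strict Implicit.
Unset Printing Implicit Defensive.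

Import Order.TTheory GRing.Theory Num.Theory.
Local Open Scope ring_scope.

(** * The weighted threshold of a load vector and how it changes *)

Section Threshold.
Variables (R : realType) (I : finType) (q : R).
Hypothesis q_ge1 : 1 <= q.
Implicit Types (l : I -> R) (i j k : I) (D p r s : R).

(* [l] takes its [k]-th largest value at an element of rank [k]; ties all get
   the largest admissible rank. *)
Definition rank l i : nat := #|[pred j | l i <= l j]|.

Definition threshold l : R := \big[Num.max/0]_i (q ^+ rank l i * l i).

Let q_ge0 : 0 <= q. Proof. exact: le_trans q_ge1. Qed.

Lemma threshold_ge0 l : 0 <= threshold l.
Proof. exact: bigmax_ge_id. Qed.

Lemma threshold_ge l i : q ^+ rank l i * l i <= threshold l.
Proof. exact: (le_bigmax 0 (fun i => q ^+ rank l i * l i)). Qed.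

Lemma rank_gt0 l i : (0 < rank l i)%N.
Proof. by apply/card_gt0P; exists i; rewrite inE. Qed.

Lemma mul_le_threshold l i : 0 <= l i -> q * l i <= threshold l.
Proof.
move=> l_ge0; apply: le_trans (threshold_ge l i).
rewrite ler_wpM2r// -[leLHS]expr1; exact: ler_weXn2l (rank_gt0 l i).
Qed.

(** Every load counts towards the rank of a minimal one, so it carries the highest power of [q].
    This later shows that the least loaded machine has room. *)
Lemma exp_card_min_le_threshold l i :
  (forall j, l i <= l j) -> q ^+ #|I| * l i <= threshold l.
Proof.
move=> min_i; apply: le_trans (threshold_ge l i).
suff -> : rank l i = #|I| by [].
by apply: eq_card => j; rewrite !inE min_i.
Qed.

Definition remaining (C : I -> R) r i : R := Num.max 0 (C i - r).

Lemma remaining_ge0 C r i : 0 <= remaining C r i.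
Proof. by rewrite le_max lexx. Qed.

(** Truncation at 0 cannot lift another load above a positive one, so at both times the rank of [i]
    counts the [j] with [C i <= C j]. *)
Lemma rank_remaining C r s i : r <= s -> 0 < remaining C s i ->
  rank (remaining C s) i = rank (remaining C r) i.
Proof.
rewrite lt_max ltxx/= => rs Ci; apply: eq_card => j; rewrite !inE /remaining.
have [Cis Cir] : 0 <= C i - s /\ 0 <= C i - r by split; lra.
rewrite (max_r Cis) (max_r Cir) !le_max.
by apply/orP/orP => -[] ?; try lra; right; lra.
Qed.

Lemma threshold_attained l : 0 < threshold l ->
  exists i, threshold l = q ^+ rank l i * l i.
Proof.
move=> T_gt0.
have [/existsP[i /eqP]|/existsPn T_neq] :=
  boolP [exists i, threshold l == q ^+ rank l i * l i]; first by exists i.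
suff : threshold l < threshold l by rewrite ltxx.
rewrite {1}/threshold bigmax_lt// => i _.
by rewrite lt_neqAle threshold_ge eq_sym T_neq.
Qed.

(* Every positive remaining load decreases at unit rate, and its weight in the
   threshold is at least [1]. *)
Lemma threshold_decay C r s : r <= s -> 0 < threshold (remaining C s) ->
  s + threshold (remaining C s) <= r + threshold (remaining C r).
Proof.
move=> rs T_gt0; have [i Ti] := threshold_attained T_gt0.
have qX_ge1 n : 1 <= q ^+ n by rewrite exprn_ege1.
have i_gt0 : 0 < remaining C s i.
  by move: T_gt0; rewrite Ti pmulr_rgt0// (lt_le_trans ltr01).
have := threshold_ge (remaining C r) i.
rewrite Ti (rank_remaining rs i_gt0).
move: i_gt0; rewrite /remaining lt_max ltxx/= => Ci.
have [Cis Cir] : 0 <= C i - s /\ 0 <= C i - r by split; lra.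
rewrite (max_r Cis) (max_r Cir).
have := qX_ge1 (rank (remaining C r) i); rewrite /remaining.
set Q := q ^+ _; nra.
Qed.

Definition add_at l k p : I -> R := fun i => if i == k then l i + p else l i.

(** Only [k] changes its load, so only [k] can newly enter the set counted by the rank of [i]. *)
Lemma rank_add_at l k p i : 0 <= p -> i != k ->
  (rank (add_at l k p) i <= (rank l i).+1)%N.
Proof.
move=> p_ge0 /negbTE ik; rewrite /rank /add_at ik.
rewrite (cardD1 k) -[leqRHS]add1n leq_add ?leq_b1//.
apply/subset_leq_card/fintype.subsetP => j.
by rewrite !inE => /andP[/negbTE ->].
Qed.

(** Crude bound for an addition to any machine: each term of the new threshold is at most [q] times
    either a term of the old one or [D]. *)
Lemma threshold_add_at_le l k p D : 0 <= p -> (forall i, 0 <= l i) ->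
  threshold l <= D -> l k + p <= D -> threshold (add_at l k p) <= q * D.
Proof.
move=> p_ge0 l_ge0 TD kD.
have D_ge0 : 0 <= D by apply: le_trans TD; exact: threshold_ge0.
apply: bigmax_le => [|i _]; first by rewrite mulr_ge0.
have qT x : x <= threshold l -> q * x <= q * D.
  by move=> xT; rewrite ler_wpM2l// (le_trans xT).
have [->{i}|ik] := eqVneq i k; last first.
  have := rank_add_at l p_ge0 ik; rewrite /add_at (negbTE ik) => rk.
  apply: le_trans (qT _ (threshold_ge l i)); rewrite mulrA -exprS ler_wpM2r//.
  exact: ler_weXn2l.
set l' := add_at l k p; have l'k : l' k = l k + p by rewrite /l' /add_at eqxx.
(* [B] collects the other machines at least as loaded as [k] after the addition. The least loaded of
   them has old rank at least [#|B|], so its old term bounds the new term of [k] up to one factor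
   [q]. If [B] is empty, [k] has rank 1 and its new load is at most [D]. *)
pose B := [pred j | (j != k) && (l' k <= l j)].
have rk : rank l' k = #|B|.+1.
  rewrite /rank (cardD1 k) inE lexx add1n; congr _.+1.
  by apply: eq_card => j; rewrite !inE /l' {2}/add_at; case: eqVneq.
rewrite rk; case: (pickP B) => [j0 Bj0|B0]; last first.
  by rewrite (eq_card0 B0) expr1 l'k ler_wpM2l.
have [j /andP[jk lj] minj] := arg_minP l Bj0.
have l'k_ge0 : 0 <= l' k by rewrite l'k addr_ge0.
rewrite exprS -mulrA qT// (le_trans _ (threshold_ge l j))//.
rewrite ler_pM ?exprn_ge0// ler_weXn2l//.
by apply/subset_leq_card/fintype.subsetP => i Bi; rewrite inE minj.
Qed.

(* If [k] does not carry the maximal load, then some larger load does not fit,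
   so that [D] is at most that load plus [p]. *)
Lemma threshold_best_fit l k p D : 0 < p -> (forall i, 0 <= l i) ->
  threshold l <= D -> l k + p <= D ->
  (forall j, l j + p <= D -> l j <= l k) ->
  threshold (add_at l k p) <= threshold l + q * p.
Proof.
move=> p_gt0 l_ge0 TD kD best.
have [/forallP max_k|/forallPn[j]] := boolP [forall j, l j <= l k]; last first.
  rewrite -ltNge => kj; apply: le_trans (threshold_add_at_le _ _ TD kD) _ => //.
    exact: ltW.
  have Dj : D <= l j + p.
    by apply: contraTT kj; rewrite -ltNge -leNgt => /ltW /best.
  rewrite (le_trans (ler_wpM2l q_ge0 Dj))// mulrDr lerD2r.
  exact: mul_le_threshold.
have qp_ge0 : 0 <= q * p by rewrite mulr_ge0// ltW.
apply: bigmax_le => [|i _]; first by rewrite addr_ge0// threshold_ge0.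
have [->{i}|ik] := eqVneq i k.
  (* Since [k] was maximal and [p] is positive, [k] becomes the strict maximum, and its term exceeds
     [q * l k] by exactly [q * p]. *)
  suff -> : rank (add_at l k p) k = 1%N.
    by rewrite /add_at eqxx mulrDr lerD2r mul_le_threshold.
  rewrite -(card1 k); apply: eq_card => j; rewrite !inE /add_at eqxx.
  by case: eqVneq => [->|_]; rewrite ?lexx// leNgt ltr_pwDr.
(* The maximal machine [k] was already counted in the rank of [i]. *)
suff -> : rank (add_at l k p) i = rank l i.
  by rewrite /add_at (negbTE ik) (le_trans (threshold_ge l i))// lerDl.
apply: eq_card => j; rewrite !inE /add_at (negbTE ik).
by case: eqVneq => [->|//]; rewrite max_k ler_wpDr// ltW.
Qed.

End Threshold.

(** * Time slots and packing by Lebesgue measure *)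

Definition slot (R : realType) (a b : R) : set R := [set` `[a, b[].

Lemma lebesgue_measure_slot (R : realType) (a b : R) :
  a <= b -> lebesgue_measure (slot a b) = (b - a)%:E.
Proof.
rewrite /slot lebesgue_measure_itv /= lte_fin EFinB le_eqVlt.
by case/predU1P => [->|->//]; rewrite ltxx subee.
Qed.

(** Half-open slots that merely touch are disjoint, so the measure of their union is the sum of
    their lengths, and monotonicity compares it with that of [W]. *)
Lemma packing_le (R : realType) n (P : {pred 'I_n}) (a b : 'I_n -> R)
    (W : set R) (w : R) :
  measurable W -> (lebesgue_measure W <= w%:E)%E ->
  (forall i, P i -> (slot (a i) (b i) `<=` W)%classic) ->
  (forall i, P i -> a i <= b i) ->
  (forall i k, P i -> P k -> i <> k -> b i <= a k \/ b k <= a i) ->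
  \sum_(i < n | P i) (b i - a i) <= w.
Proof.
move=> mW muW sub ab disj; rewrite -lee_fin; apply: le_trans muW.
have mslot i : P i -> measurable (slot (a i) (b i)).
  by move=> _; exact: measurable_itv.
have triv : trivIset P (fun i => slot (a i) (b i)).
  move=> i k Pi Pk [x []]; rewrite /slot /= !in_itv /=.
  move=> /andP[ai bi] /andP[ak bk].
  have [//|/eqP ik] := eqVneq i k.
  case: (disj i k Pi Pk ik) => h.
    by have := lt_le_trans bi (le_trans h ak); rewrite ltxx.
  by have := lt_le_trans bk (le_trans h ai); rewrite ltxx.
apply: (@le_trans _ _
  (lebesgue_measure (\big[setU/set0]_(i < n | P i) slot (a i) (b i))%classic)).
  rewrite measure_bigsetU_ord_cond// -sumEFin; apply: lee_sum => i Pi.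
  by rewrite -lebesgue_measure_slot ?ab.
apply: le_measure; rewrite ?inE//.
  exact: bigsetU_measurable.
elim/big_ind: _ => [|A B AW BW|i Pi]; last exact: sub.
  exact: sub0set.
by rewrite subUset.
Qed.

(** * The threshold algorithm and its state *)

Section Algorithm.
Variables (R : realType) (m : nat) (q : R).
Implicit Types (C : 'I_m -> R) (x : job R) (s : seq (job R)).

(* The state [C] of the algorithm is the completion time of each machine. *)
Definition fits C x (k : 'I_m) : bool :=
  remaining C (release x) k + proc x <= deadline x - release x.

Definition best_fit C x : option 'I_m :=
  [pick k | fits C x k &&
     [forall j, fits C x j ==>
        (remaining C (release x) j <= remaining C (release x) k)]].

(** The starting time equals the maximum of the release date and the completion time of machine
    [k]. *)
Definition decide C x : decision R m :=
  if threshold q (remaining C (release x)) <= deadline x - release x then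
    omap (fun k => (k, release x + remaining C (release x) k)) (best_fit C x)
  else None.

Definition step C x : 'I_m -> R :=
  if decide C x is Some (k, t) then
    fun i => if i == k then t + proc x else C i
  else C.

Definition state C s : 'I_m -> R := foldl step C s.

Definition threshold_algorithm : online_algorithm R m :=
  fun past x => decide (state (fun=> 0) past) x.

Lemma decide_Some C x k t : decide C x = Some (k, t) ->
  [/\ t = release x + remaining C (release x) k,
      threshold q (remaining C (release x)) <= deadline x - release x,
      fits C x k &
      forall j, fits C x j ->
        remaining C (release x) j <= remaining C (release x) k].
Proof.
rewrite /decide; case: ifP => // T_le; rewrite /best_fit.
case: pickP => [k' /andP[fk /forallP best]|//] [<- <-]; split => // j fj.
exact: (implyP (best j)).
Qed.

Lemma start_ge_completion C x k :
  C k <= release x + remaining C (release x) k.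
Proof. by rewrite -lerBlDl le_max lexx orbT. Qed.

Lemma step_ge C x k : 0 < proc x -> C k <= step C x k.
Proof.
rewrite /step => p_gt0; case E: (decide C x) => [[j t]|//].
case: eqVneq => // ->; have [-> _ _ _] := decide_Some E.
by rewrite ler_wpDr ?start_ge_completion// ltW.
Qed.

Lemma state_ge C s k : all (fun x => 0 < proc x) s -> C k <= state C s k.
Proof.
rewrite /state; elim: s C => [|x s IHs] C //= /andP[p_gt0 ps].
exact: le_trans (step_ge C k p_gt0) (IHs _ ps).
Qed.

(** Isolates the step made for job [i] within the run up to job [k], so that monotonicity of the
    state applies to the remaining steps. *)
Lemma state_take C s x0 i k : (i < k <= size s)%N ->
  state C (take k s) =
  state (step (state C (take i s)) (nth x0 s i)) (drop i.+1 (take k s)).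
Proof.
move=> /andP[ik ks]; rewrite /state -[in LHS](cat_take_drop i.+1 (take k s)).
rewrite take_takel// (take_nth x0) ?(leq_trans ik)//.
by rewrite foldl_cat -cats1 foldl_cat.
Qed.

Lemma remaining_step C x k t : decide C x = Some (k, t) -> 0 <= proc x ->
  remaining (step C x) (release x)
  = add_at (remaining C (release x)) k (proc x).
Proof.
move=> E p_ge0; apply/funext => i; rewrite /step E /add_at.
have [-> _ _ _] := decide_Some E; case: eqVneq => [->|ik]; last first.
  by rewrite /remaining (negbTE ik).
have := remaining_ge0 C (release x) k; set l := remaining C _ _ => l_ge0.
by rewrite /remaining eqxx max_r; lra.
Qed.

Hypothesis q_ge1 : 1 <= q.

Lemma threshold_step C x k t : decide C x = Some (k, t) -> 0 < proc x ->
  threshold q (remaining (step C x) (release x))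
  <= threshold q (remaining C (release x)) + q * proc x.
Proof.
move=> E p_gt0; rewrite (remaining_step E (ltW p_gt0)).
have [_ TD kD best] := decide_Some E.
exact: (threshold_best_fit q_ge1 p_gt0 (remaining_ge0 C _) TD kD best).
Qed.

(** * Rejected jobs and the measure of the blocked time *)

Variable eps : R.
Hypotheses (eps_gt0 : 0 < eps) (m_gt0 : (0 < m)%N).
Hypothesis exp_q : q ^+ m = (1 + eps) / eps.

Definition good_job x : bool :=
  (0 < proc x) && ((1 + eps) * proc x <= deadline x - release x).

(** A job that passes the threshold test always finds a machine, so rejection means failing the
    test. The choice of [q] enters here. *)
Lemma decide_None C x : good_job x -> decide C x = None ->
  deadline x - release x < threshold q (remaining C (release x)).
Proof.
move=> /andP[p_gt0 slack]; rewrite /decide ltNge; case: ifP => // T_le.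
set l := remaining C (release x).
have [k _ min_k] := arg_minP l (erefl : xpredT (Ordinal m_gt0)).
have lk_fits : fits C x k.
  have := exp_card_min_le_threshold q (fun j => min_k j isT).
  rewrite card_ord exp_q => /le_trans /(_ T_le).
  have eps1_gt0 : 0 < 1 + eps by rewrite addr_gt0.
  rewrite mulrAC ler_pdivrMr// /fits -/l.
  (* After scaling by [1 + eps], the threshold bounds the load part by
     [eps * (deadline x - release x)], and the slack condition bounds the processing part by
     [deadline x - release x]. *)
  by rewrite -[in X in _ -> X](ler_pM2l eps1_gt0); lra.
rewrite /best_fit; case: pickP => [//|no_best].
(* Once some machine fits, a most loaded fitting one exists, so the search in [best_fit] cannot
   fail. *)
have [k' fk' max_k'] := arg_maxP l lk_fits.
have /negP[] := negbT (no_best k'); rewrite fk' /=.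
by apply/forallP => j; apply/implyP => /max_k'.
Qed.

Definition decision_at C s (i : 'I_(size s)) : decision R m :=
  decide (state C (take i s)) (job_at i).

(* [W] covers all the windows that can still be blocked by the current loads;
   an accepted job of length [p] prolongs them by at most [q * p], and every
   rejected job lies in a window. *)
Lemma rejected_cover s C r (W : set R) (w : R) :
    all good_job s ->
    pairwise (fun x y => release x <= release y) s ->
    all (fun x => r <= release x) s ->
    measurable W -> (lebesgue_measure W <= w%:E)%E ->
    (forall t, r <= t ->
       (slot t (t + threshold q (remaining C t)) `<=` W)%classic) ->
  exists W' : set R,
    [/\ measurable W', (W `<=` W')%classic,
      (lebesgue_measure W' <=
       (w + q * \sum_(i < size s | isSome (decision_at C i))
                  proc (job_at i))%:E)%E &
      forall i : 'I_(size s), decision_at C i = None ->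
        (slot (release (job_at i)) (deadline (job_at i)) `<=` W')%classic].
Proof.
elim: s C r W w => [|x s IHs] C r W w.
  by exists W; split=> //; [rewrite big_ord0 mulr0 addr0 | case].
move=> /= /andP[gx gs] /andP[xs ps] /andP[rx rs] mW muW cW.
have p_gt0 : 0 < proc x by case/andP: gx.
have dec0 : decision_at C (ord0 : 'I_(size (x :: s))) = decide C x by [].
have decS i : decision_at C (lift ord0 i : 'I_(size (x :: s)))
    = decision_at (step C x) i.
  by rewrite /decision_at /job_at !(tnth_nth x).
have jobS i : job_at (lift ord0 i : 'I_(size (x :: s))) = job_at i.
  by rewrite /job_at !(tnth_nth x).
have sumS :
    \sum_(i < size (x :: s) | isSome (decision_at C i)) proc (job_at i) =
    (if decide C x is Some _ then proc x else 0) +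
    \sum_(i < size s | isSome (decision_at (step C x) i)) proc (job_at i).
  rewrite big_mkcond big_ord_recl dec0 [in RHS]big_mkcond; congr (_ + _).
    by case: (decide C x).
  by apply: eq_bigr => i _; rewrite decS jobS.
have coverS (W' : set R) :
    (decide C x = None ->
       (slot (release x) (deadline x) `<=` W')%classic) ->
    (forall i : 'I_(size s), decision_at (step C x) i = None ->
       (slot (release (job_at i)) (deadline (job_at i)) `<=` W')%classic) ->
  forall i : 'I_(size (x :: s)), decision_at C i = None ->
    (slot (release (job_at i)) (deadline (job_at i)) `<=` W')%classic.
  move=> cx cs i; have [j ->|->] := unliftP ord0 i; last exact: cx.
  by rewrite decS jobS; exact: cs.
set T := threshold q (remaining C (release x)).
case E: (decide C x) sumS => [[k t]|] sumS; last first.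
  have stepE : step C x = C by rewrite /step E.
  have [] := IHs (step C x) (release x) W w gs ps xs mW muW.
    by rewrite stepE => t xt; apply: cW; exact: le_trans xt.
  move=> W' [mW' WW' muW' cW']; exists W'; split => //.
    by rewrite sumS add0r.
  apply: coverS => // _ z; rewrite /slot /= in_itv /= => /andP[xz zx].
  apply/WW'/(cW _ rx); rewrite /slot /= in_itv /= xz /=.
  by have := decide_None gx E; rewrite -/T; lra.
have T_step := threshold_step E p_gt0.
(* The window blocked at the release of [x] ends at [release x + T] before acceptance and at most
   [q * proc x] later after it, so one extra slot of that length suffices. *)
pose W1 : set R :=
  (W `|` slot (release x + T) (release x + T + q * proc x))%classic.
have mW1 : measurable W1 by apply: measurableU => //; exact: measurable_itv.
have muW1 : (lebesgue_measure W1 <= (w + q * proc x)%:E)%E.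
  apply: (le_trans (measureU2 _ _ _)) => //; first exact: measurable_itv.
  have qp_ge0 : 0 <= q * proc x.
    by apply: mulr_ge0; [exact: le_trans q_ge1 | exact: ltW].
  rewrite EFinD leeD//; apply: (@le_trans _ _ (lebesgue_measure
    (slot (release x + T) (release x + T + q * proc x)))); first exact: lexx.
  by rewrite lebesgue_measure_slot ?lerDl// addrC addKr.
have cW1 : forall t, release x <= t ->
    (slot t (t + threshold q (remaining (step C x) t)) `<=` W1)%classic.
  move=> u xu z; rewrite /slot /= in_itv /= => /andP[uz zu].
  have T_gt0 : 0 < threshold q (remaining (step C x) u).
    by rewrite -(ltrDl u) (le_lt_trans uz).
  have decay := threshold_decay q_ge1 xu T_gt0.
  (* A point before [release x + T] was already covered by the old window. A later one lies in the
     added slot, because by [decay] the window at [u] ends no later than the new window at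
     [release x]. *)
  have [zT|Tz] := ltP z (release x + T).
    by left; apply: (cW _ rx); rewrite /slot /= in_itv /= zT andbT; lra.
  by right; rewrite /slot /= in_itv /= Tz /=; rewrite -/T in T_step; lra.
have [W' [mW' WW' muW' cW']] :=
  IHs (step C x) (release x) W1 (w + q * proc x) gs ps xs mW1 muW1 cW1.
exists W'; split => //.
- by move=> z Wz; apply: WW'; left.
- by rewrite sumS mulrDr addrA.
- by apply: coverS cW'; rewrite E.
Qed.

(** * Feasibility and the competitive ratio *)

Lemma valid_good (J : seq (job R)) : valid_instance eps J ->
  all good_job J /\ pairwise (fun x y => release x <= release y) J.
Proof.
move=> [jobP releaseP]; pose x0 := Job 0 0 0 : job R.
split.
  apply/(all_nthP x0) => i iJ; have [_ p_gt0 slack] := jobP (Ordinal iJ).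
  by move: p_gt0 slack; rewrite /job_at (tnth_nth x0) => ? ?; apply/andP.
apply/(pairwiseP x0) => i k; rewrite !inE => iJ kJ ik; rewrite leNgt.
apply/negP => ki; have := releaseP (Ordinal kJ) (Ordinal iJ).
by rewrite /job_at !(tnth_nth x0) /= => /(_ ki); rewrite ltnNge ltnW.
Qed.

Lemma online_scheduleE (J : seq (job R)) :
  online_schedule threshold_algorithm J = decision_at (fun=> 0) (s := J).
Proof. by []. Qed.

Lemma threshold_algorithm_correct : correct eps threshold_algorithm.
Proof.
move=> J /valid_good[gJ _]; rewrite online_scheduleE; split.
  move=> i M t /decide_Some[-> _ fM _]; rewrite lerDl remaining_ge0; split=> //.
  by move: fM; rewrite /fits; lra.
have pJ : all (fun x => 0 < proc x) J by apply: sub_all gJ => x /andP[].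
(* Accepting job [i] sets the completion time of [M] to its end; completion times never decrease,
   and job [k] starts no earlier than the current one. *)
have ordered (i k : 'I_(size J)) M t u : (i < k)%N ->
    decision_at (fun=> 0) i = Some (M, t) ->
    decision_at (fun=> 0) k = Some (M, u) -> t + proc (job_at i) <= u.
  move=> ik Ei Ek; have [-> _ _ _] := decide_Some Ek.
  apply: le_trans (start_ge_completion _ _ _).
  have ikJ : (i < k <= size J)%N by rewrite ik ltnW.
  rewrite (state_take _ (job_at i) ikJ).
  have -> : nth (job_at i) J i = job_at i.
    by rewrite -(tnth_nth _ (in_tuple J)).
  have Ei' : decide (state (fun=> 0) (take i J)) (job_at i) = Some (M, t) by [].
  apply: le_trans (state_ge _ _ _); first by rewrite /step Ei' eqxx.
  move: pJ; rewrite -[in all _ J](cat_take_drop k J) all_cat => /andP[+ _].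
  by rewrite -[in all _ _](cat_take_drop i.+1 (take k J)) all_cat => /andP[].
move=> i k M t u ik Ei Ek.
have [ltik|ltki|/val_inj //] := ltngtP i k.
  by left; exact: ordered Ei Ek.
by right; exact: ordered Ek Ei.
Qed.

(** The jobs of [P] on one machine occupy disjoint slots inside [W], so their total length is at
    most [w]; summing over the machines gives the factor [m]. *)
Lemma load_le_cover (J : seq (job R)) (S : schedule m J)
    (P : {pred 'I_(size J)}) (W : set R) (w : R) :
  feasible S -> {subset P <= accepted S} ->
  measurable W -> (lebesgue_measure W <= w%:E)%E ->
  (forall i, P i -> 0 < proc (job_at i)) ->
  (forall i, P i ->
    (slot (release (job_at i)) (deadline (job_at i)) `<=` W)%classic) ->
  \sum_(i < size J | P i) proc (job_at i) <= m%:R * w.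
Proof.
move=> [windowS disjS] PS mW muW p_gt0 PW.
(* The default values never matter on [P], where [S] assigns a machine and a start. *)
pose mach i := if S i is Some (M, _) then M else Ordinal m_gt0.
pose start i := if S i is Some (_, t) then t else 0.
have SE i : P i -> S i = Some (mach i, start i).
  by move=> /PS; rewrite inE /mach /start; case: (S i) => [[]|].
rewrite (partition_big mach xpredT)//=.
have -> : m%:R * w = \sum_(M < m) w by rewrite sumr_const card_ord mulr_natl.
apply: ler_sum => M _.
rewrite (eq_bigr (fun i => start i + proc (job_at i) - start i)); last first.
  by move=> i _; rewrite addrAC subrr add0r.
apply: packing_le mW muW _ _ _.
- move=> i /andP[Pi _] z; rewrite /slot /= in_itv /= => /andP[tz zt].
  have [rt td] := windowS _ _ _ (SE _ Pi).
  apply: (PW _ Pi); rewrite /slot /= in_itv /= (le_trans rt)//=.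
  exact: lt_le_trans td.
- by move=> i /andP[Pi _]; rewrite lerDl ltW// p_gt0.
- move=> i k /andP[Pi /eqP iM] /andP[Pk /eqP kM] ik.
  by apply: (disjS i k M) => //; rewrite SE// (iM, kM).
Qed.

Lemma threshold_algorithm_competitive :
  strictly_competitive eps (m%:R * q + 1) threshold_algorithm.
Proof.
move=> J validJ; have [gJ pJ] := valid_good validJ.
set alg := ALG _ _.
have algE : alg = \sum_(i < size J | isSome (decision_at (fun=> 0) i))
    proc (job_at i).
  by rewrite /alg /ALG /load online_scheduleE; apply: eq_bigl => i; rewrite inE.
have p_gt0 (i : 'I_(size J)) : 0 < proc (job_at i) by have [[]] := validJ.1 i.
have alg_ge0 : 0 <= alg by rewrite algE sumr_ge0// => i _; rewrite ltW.
have q_ge0 : 0 <= q by exact: le_trans q_ge1.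
have r_ge0 : all (fun x => 0 <= release x) J.
  apply/(all_nthP (Job 0 0 0)) => i iJ; have [+ _ _] := validJ.1 (Ordinal iJ).
  by rewrite /job_at (tnth_nth (Job 0 0 0)).
have muW0 : (lebesgue_measure (set0 : set R) <= 0%:E)%E by rewrite measure0.
(* Initially nothing is blocked: all completion times are 0, so the empty set is a valid starting
   cover. *)
have cW0 (t : R) : 0 <= t ->
    (slot t (t + threshold q (remaining (fun _ : 'I_m => 0) t))
       `<=` set0)%classic.
  move=> t_ge0; rewrite (_ : threshold _ _ = 0).
    move=> z; rewrite /slot /= addr0 in_itv /= => /andP[tz /(le_lt_trans tz)].
    by rewrite ltxx.
  apply/eqP; rewrite eq_le threshold_ge0 andbT; apply: bigmax_le => // i _.
  by rewrite /remaining max_l ?mulr0// sub0r oppr_le0.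
have [W [mW _ muW cW]] := rejected_cover gJ pJ r_ge0 measurable0 muW0 cW0.
rewrite add0r -algE in muW.
apply: bigmax_le => [|A /asboolP[S [feasS accS]]].
  by rewrite mulr_ge0// addr_ge0// mulr_ge0.
(* The offline jobs are split by the online decision: those also accepted online weigh at most
   [alg], which gives the summand 1, and the rejected ones fit into [W], which gives [m%:R * q]. *)
rewrite /load (bigID (fun i => isSome (decision_at (fun=> 0) i)))/=.
rewrite mulrDl mul1r addrC lerD//; last first.
  rewrite algE big_mkcond [leRHS]big_mkcond ler_sum// => i _.
  by case: (i \in A) => //=; case: ifP => // _; rewrite ltW.
rewrite -mulrA; apply: (load_le_cover feasS _ mW muW) => [i|i _|i /andP[_]] //.
  by rewrite accS => /andP[].
by case E: (decision_at _ i) => // _; exact: cW.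
Qed.

End Algorithm.

Theorem theorem4 (R : realType) (m : nat) (eps : R)
    (hm : (1 <= m)%N) (heps0 : 0 < eps) (heps1 : eps <= 1) :
  exists alg : online_algorithm R m,
    correct eps alg /\
    strictly_competitive eps
      (m%:R * ((1 + eps) / eps) `^ (1 / m%:R) + 1) alg.
Proof.
set q := _ `^ _.
have base_ge1 : 1 <= (1 + eps) / eps.
  by rewrite ler_pdivlMr// mul1r lerDr.
have q_ge1 : 1 <= q.
  by rewrite -(powRr0 ((1 + eps) / eps)) ler_powR// divr_ge0.
have exp_q : q ^+ m = (1 + eps) / eps.
  rewrite -powR_mulrn ?powR_ge0// -powRrM div1r mulVf ?pnatr_eq0 -?lt0n//.
  by rewrite powRr1// (le_trans ler01).
exists (threshold_algorithm m q); split.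
  exact: threshold_algorithm_correct.
exact: threshold_algorithm_competitive.
Qed.
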